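(* Let $u^{N}\in\mathcal M_N$ be a solution of $\mathcal L(u^{N};g)=\min_{v\in\mathcal M_N}\mathcal L(v;g)$ and let $u^{N}_{\mathcal T}\in\mathcal M_N$ be a solution of $\mathcal L_{\mathcal T}(u^{N}_{\mathcal T};g)=\min_{v\in\mathcal M_N}\mathcal L_{\mathcal T}(v;g)$. Then $$\mathcal L(u^{N}_{\mathcal T};g)\le\big|(\mathcal L-\mathcal L_{\mathcal T})(u^{N}_{\mathcal T};g)\big|+\big|(\mathcal L-\mathcal L_{\mathcal T})(u^{N};g)\big|+\big|\mathcal L(u^{N};g)\big|.$$
   Context: Let $\tilde\Omega\subset\mathbb R^d$ ($d=1,2,3$) be a bounded domain with Lipschitz boundary, $I=(0,T)$, $\Omega=\tilde\Omega\times I\subset\mathbb R^{d+1}$, with variable $\mathbf z=(\mathbf x,t)$. The space-time flux is $\mathbf f(u)=(f_1(u),\dots,f_d(u),u)$ with each $f_i$ twice differentiable, and $\mathbf{div}$ is the divergence in all variables $(\mathbf x,t)$. $\Gamma_-=\tilde\Gamma_-\cup(\tilde\Omega\times\{0\})$ is the inflow boundary, where $\tilde\Gamma_-$ is the part of $\partial\tilde\Omega\times I$ where characteristics enter $\Omega$; $g$ is given data on $\Gamma_-$. The least-squares functional is $\mathcal L(v;g)=\|\mathbf{div}\,\mathbf f(v)\|_{0,\Omega}^2+\|v-g\|_{0,\Gamma_-}^2$, with $\|\cdot\|_{0,S}$ the $L^2(S)$ norm. $\mathcal M_N$ is the set of scalar functions on $\mathbb R^{d+1}$ given by $l$-layer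 fully connected ReLU networks with fixed widths $n_0=d+1,n_1,\dots,n_{l-1},n_l=1$: $\mathcal N(\mathbf z)=\boldsymbol\omega^{(l)}\big(N^{(l-1)}\circ\cdots\circ N^{(1)}(\mathbf z)\big)-b^{(l)}$, $N^{(k)}(\mathbf y)=\tau(\boldsymbol\omega^{(k)}\mathbf y-\mathbf b^{(k)})$, where $\tau(s)=\max\{0,s\}$ is applied componentwise and all weights $\boldsymbol\omega^{(k)}\in\mathbb R^{n_k\times n_{k-1}}$ and biases $\mathbf b^{(k)}\in\mathbb R^{n_k}$ are free; $N=\sum_{k=1}^l n_k(n_{k-1}+1)$. Let $\mathcal T=\{K\}$ be a (finite) partition of $\Omega$ into open subdomains and $\mathcal E_-=\{E=\partial K\cap\Gamma_-:K\in\mathcal T\}$ the induced partition of $\Gamma_-$. For $K\in\mathcal T$, $E\in\mathcal E_-$ let $\mathcal Q_K$, $\mathcal Q_E$ be Newton–Cotes quadratures for integrals over $K$ and $E$. Let $\mathbf{div}_{\mathcal T}$ be a discrete divergence operator, i.e. a rule assigning to $\mathbf f(v)$, $v\in\mathcal M_N$, real values at the quadrature points that approximate $\mathbf{div}\,\mathbf f(v)$ there. The discrete least-squares functional is $$\mathcal L_{\mathcal T}(v;g)=\sum_{K\in\mathcal T}\mathcal Q_K^2\big(\mathbf{div}_{\mathcal T}\,\mathbf f(v)\big)+\sum_{E\in\mathcal E_-}\mathcal Q_E^2(v-g),$$ where $\mathcal Q_K^2(\cdot)=(\mathcal Q_K(\cdot))^2$ and similarly for $\mathcal Q_E^2$.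 *)

(* Defs.v *)
From HB Require Import structures.
From mathcomp Require Import all_boot all_order all_algebra finmap.
From mathcomp Require Import all_classical all_reals all_analysis.

Set Implicit Arguments.
Unset Strict Implicit.
Unset Printing Implicit Defensive.
Import Order.TTheory GRing.Theory Num.Theory.
Import numFieldNormedType.Exports.

Local Open Scope classical_set_scope.
Local Open Scope ring_scope.

(** * Euclidean geometry of column vectors

    The library norm on matrices is the sup norm; the Euclidean norm is needed
    for diameters in the Hausdorff measure. *)

Section euclidean.
Context {R : realType} {n : nat}.
Implicit Types (x y : 'cV[R]_n) (A : set 'cV[R]_n).

Definition dotp x y : R := \sum_i x i 0 * y i 0.

Definition enorm x : R := Num.sqrt (dotp x x).

Definition ediam A : \bar R :=
  ereal_sup [set (enorm (xy.1 - xy.2))%:E | xy in A `*` A].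

Definition boundary A : set 'cV[R]_n := closure A `\` A°.

Definition domain A := [/\ open A, connected A & A !=set0].

(** Near each boundary point the set is, in suitable orthonormal coordinates,
    the strict hypograph of a Lipschitz function: [e] is the vertical direction
    and [x - dotp x e *: e] the projection of [x] on the hyperplane orthogonal
    to [e]. *)
Definition lipschitz_boundary A := forall p, boundary A p ->
  exists (e : 'cV[R]_n) (gam : 'cV[R]_n -> R),
    [/\ enorm e = 1, [lipschitz gam x | x in setT] &
        \forall x \near p, A x <-> dotp x e < gam (x - dotp x e *: e)].

End euclidean.

(** * Lebesgue and Hausdorff measures on R^n

    Both are obtained from a weight on arbitrary sets by the library's outer
    measure [mu_ext] (infimum of the total weight over countable covers) and then
    restricted to Caratheodory measurable sets.  [mu_ext] asks for a family of
    sets allowed in the covers; [all_sets T] is [T] with every set allowed. *)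

Definition all_sets (T : Type) := T.

HB.instance Definition _ (T : pointedType) := Pointed.on (all_sets T).
HB.instance Definition _ (T : pointedType) := @isMeasurable.Build default_measure_display
  (all_sets T) discrete_measurable (@discrete_measurable0 T)
  (@discrete_measurableC T) (@discrete_measurableU T).

Section lebesgue.
Context (R : realType) (n : nat).
Local Open Scope ereal_scope.

Definition box (a b : 'cV[R]_n) : set 'cV[R]_n :=
  [set x | forall i, (a i 0 <= x i 0 <= b i 0)%R].

(** Least volume of a box containing [A]; the empty set has weight 0 in
    dimension 0 as well. *)
Definition box_weight (A : set (all_sets 'cV[R]_n)) : \bar R :=
  if A == set0 then 0 else
  ereal_inf [set (\prod_i (ab.2 i 0 - ab.1 i 0)%R)%:E | ab in
    [set ab : 'cV[R]_n * 'cV[R]_n |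
      (forall i, ab.1 i 0 <= ab.2 i 0)%R /\ A `<=` box ab.1 ab.2]].

Lemma box_weight0 : box_weight set0 = 0.
Proof. by rewrite /box_weight eqxx. Qed.

Lemma box_weight_ge0 A : 0 <= box_weight A.
Proof.
rewrite /box_weight; case: ifP => // _.
apply: le_ereal_inf_tmp => _ [[a b] /= [ab _] <-].
by rewrite lee_fin prodr_ge0// => i _; rewrite subr_ge0.
Qed.

Definition lebesgue (A : set 'cV[R]_n) : \bar R := mu_ext box_weight A.

HB.instance Definition _ := isOuterMeasure.Build R 'cV[R]_n lebesgue
  (mu_ext0 box_weight0 box_weight_ge0) (mu_ext_ge0 box_weight_ge0)
  (le_mu_ext box_weight) (mu_ext_sigma_subadditive box_weight_ge0).

End lebesgue.

Section hausdorff.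
Context (R : realType) (n s : nat).
Local Open Scope ereal_scope.

(** The Lebesgue measure of the unit ball of R^s is the normalisation for which
    the [s]-dimensional Hausdorff measure is the usual surface measure on
    [s]-dimensional Lipschitz surfaces. *)
Definition hausdorff_weight (delta : R) (A : set (all_sets 'cV[R]_n)) : \bar R :=
  if A == set0 then 0 else
  if ediam (A : set 'cV[R]_n) <= delta%:E then
    lebesgue [set x : 'cV[R]_s | (enorm x <= 1)%R] *
      ((fine (ediam (A : set 'cV[R]_n)) / 2) ^+ s)%:E
  else +oo.

Lemma hausdorff_weight0 delta : hausdorff_weight delta set0 = 0.
Proof. by rewrite /hausdorff_weight eqxx. Qed.

Lemma hausdorff_weight_ge0 delta A : 0 <= hausdorff_weight delta A.
Proof.
rewrite /hausdorff_weight; case: eqP => // /eqP/set0P[x Ax].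
case: ifP => // _; rewrite mule_ge0 ?outer_measure_ge0//.
rewrite lee_fin exprn_ge0// divr_ge0// fine_ge0//.
rewrite (@le_trans _ _ (enorm (x - x))%:E) ?lee_fin ?sqrtr_ge0//.
by apply: ereal_sup_ubound; exists (x, x).
Qed.

Definition hausdorff_delta delta (A : set 'cV[R]_n) : \bar R :=
  mu_ext (hausdorff_weight delta) A.

Definition hausdorff (A : set 'cV[R]_n) : \bar R :=
  ereal_sup [set hausdorff_delta delta A | delta in [set delta | (0 < delta)%R]].

Lemma hausdorff0 : hausdorff set0 = 0.
Proof.
rewrite /hausdorff [X in ereal_sup X](_ : _ = [set 0]) ?ereal_sup1//.
have H (delta : R) : hausdorff_delta delta set0 = 0.
  exact: (mu_ext0 (hausdorff_weight0 delta) (hausdorff_weight_ge0 delta)).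
apply/seteqP; split=> [_ [delta _ <-]|_ ->] /=; first exact: H.
by exists 1%R => //=.
Qed.

Lemma hausdorff_ge0 A : 0 <= hausdorff A.
Proof.
rewrite (@le_trans _ _ (hausdorff_delta 1 A))//.
  exact: (mu_ext_ge0 (hausdorff_weight_ge0 1)).
by apply: ereal_sup_ubound; exists 1%R => //=.
Qed.

Lemma le_hausdorff : {homo hausdorff : A B / A `<=` B >-> A <= B}.
Proof.
move=> A B AB; apply: ge_ereal_sup => _ [delta d0 <-].
apply: (@le_trans _ _ (hausdorff_delta delta B)).
  exact: (le_mu_ext (hausdorff_weight delta) AB).
by apply: ereal_sup_ubound; exists delta.
Qed.

Lemma hausdorff_sigma_subadditive : sigma_subadditive hausdorff.
Proof.
move=> F; apply: ge_ereal_sup => _ [delta d0 <-].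
apply: (le_trans (mu_ext_sigma_subadditive (hausdorff_weight_ge0 delta) F)).
apply: lee_nneseries => [k _ _|k _].
  exact: (mu_ext_ge0 (hausdorff_weight_ge0 delta)).
by apply: ereal_sup_ubound; exists delta.
Qed.

HB.instance Definition _ := isOuterMeasure.Build R 'cV[R]_n hausdorff
  hausdorff0 hausdorff_ge0 le_hausdorff hausdorff_sigma_subadditive.

End hausdorff.

Section L2.
Context {R : realType} {T : pointedType}.
Variables (mu : {outer_measure set T -> \bar R}) (S : set T).

Definition L2norm (f : T -> R) : \bar R :=
  Lnorm (mu : {measure set (caratheodory_type mu) -> \bar R}) 2%:E
    (fun z => (\1_S z * f z)%:E).

Definition square_integrable (f : T -> R) :=
  [/\ mu.-cara.-measurable S,
      measurable_fun (S : set (caratheodory_type mu)) f &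
      (L2norm f < +oo)%E].

End L2.

(** * Space-time setting

    A point of R^(d+1) is [z = (x, t)] with the time in the last coordinate. *)

Section spacetime.
Context {R : realType} {d : nat}.
Notation pt := 'cV[R]_d.+1.

Definition space (z : pt) : 'cV[R]_d := row' ord_max z.
Definition time (z : pt) : R := z ord_max 0.

Definition cylinder (Ot : set 'cV[R]_d) (Tend : R) : set pt :=
  [set z | Ot (space z) /\ 0 < time z < Tend].

Definition lateral (Ot : set 'cV[R]_d) (Tend : R) : set pt :=
  [set z | boundary Ot (space z) /\ 0 < time z < Tend].

Definition bottom (Ot : set 'cV[R]_d) : set pt :=
  [set z | Ot (space z) /\ time z = 0].

Variable f : 'I_d -> R -> R.

Definition stflux (s : R) : pt :=
  \col_i if unlift ord_max i is Some j then f j s else s.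

(** Space-time direction of the characteristic carrying the value [s]. *)
Definition char_dir (s : R) : pt :=
  \col_i if unlift ord_max i is Some j then derive1 (f j) s else 1.

(** Characteristics of a scalar conservation law whose flux depends on the
    solution only are straight lines, along which the solution is constant. *)
Definition enters (Om : set pt) (s : R) (z : pt) :=
  \forall h \near 0^'+,
    Om (z + h *: char_dir s) /\ ~ Om (z - h *: char_dir s).

(** The law is nonlinear, so that the inflow boundary depends on the values [u]
    carried by the characteristics at the lateral boundary. *)
Definition inflow (Ot : set 'cV[R]_d) (Tend : R) (u : pt -> R) : set pt :=
  (lateral Ot Tend `&` [set z | enters (cylinder Ot Tend) (u z) z])
  `|` bottom Ot.

(** For a ReLU network [v] the field [stflux \o v] is locally Lipschitz, hence
    differentiable almost everywhere, and the pointwise divergence represents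
    the distributional one. *)
Definition stdiv (F : pt -> pt) (z : pt) : R :=
  \sum_i 'D_(delta_mx i 0) (fun y => F y i 0) z.

Definition ls_functional (Om Gm : set pt) (g v : pt -> R) : \bar R :=
  (L2norm (@lebesgue R d.+1) Om (stdiv (stflux \o v)) ^+ 2 +
   L2norm (@hausdorff R d.+1 d) Gm (v \- g)%R ^+ 2)%E.

End spacetime.

(** * ReLU networks *)

Section relu.
Context {R : realType}.

Definition relu (s : R) : R := Num.max 0 s.

(** [relu_net ws m]: networks with input dimension [m], hidden widths [ws] and
    output dimension 1, hence [(size ws).+1] layers; [w] and [b] are the weights
    and the bias of the first layer. *)
Fixpoint relu_net (ws : seq nat) (m : nat) : set ('cV[R]_m -> R) :=
  match ws with
  | [::] => [set N | exists (w : 'rV[R]_m) (b : R),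
      forall y, N y = (w *m y) 0 0 - b]
  | n :: ws' => [set N | exists (w : 'M[R]_(n, m)) (b : 'cV[R]_n) N',
      relu_net ws' N' /\ forall y, N y = N' (map_mx relu (w *m y - b))]
  end.

End relu.

(** * Newton-Cotes quadrature *)

Section quadrature.
Context {R : realType} {n : nat}.
Notation pt := 'cV[R]_n.
Notation index := 'cV[nat]_n.

Definition monomial (b : index) (y : pt) : R := \prod_i y i 0 ^+ b i 0.

(** Equally spaced nodes: lattice points in the coordinates of origin [a] whose
    axes are the columns of [H]. *)
Definition node (a : pt) (H : 'M[R]_n) (al : index) : pt :=
  a + H *m map_mx (fun k => k%:R) al.

(** The polynomial with coefficients [c] on the monomials of [I], in the lattice
    coordinates. *)
Definition lattice_poly (a : pt) (H : 'M[R]_n) (I : {fset index})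
    (c : index -> R) (z : pt) : R :=
  \sum_(b <- I) c b * monomial b (invmx H *m (z - a)).

(** Interpolatory rule with equally spaced nodes: the weights are the integrals
    of the Lagrange polynomials [l_al] of the nodes.  The set [I] of
    multi-indices is downward closed and indexes both the nodes and the
    monomials, so that interpolation is unisolvent.  With
    [I = {al | forall i, al_i <= k_i}] this is the tensor product rule on boxes,
    with [I = {al | sum_i al_i <= k}] the rule on simplices; rules on faces have
    a single layer of nodes in the transversal direction. *)
Definition newton_cotes_simple (mu : {outer_measure set pt -> \bar R})
    (S : set pt) (Q : (pt -> R) -> R) :=
  exists (a : pt) (H : 'M[R]_n) (I : {fset index}) (c : index -> index -> R),
    [/\ H \in unitmx,
        I != fset0 /\ (forall al be : index, al \in I ->
          (forall i, be i ord0 <= al i ord0)%N -> be \in I),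
        (forall al be, al \in I -> be \in I ->
          lattice_poly a H I (c al) (node a H be) = (al == be)%:R),
        (forall al, al \in I -> closure S (node a H al)) &
        forall phi, Q phi = \sum_(al <- I)
          (\int[mu : {measure set (caratheodory_type mu) -> \bar R}]_(z in S)
             lattice_poly a H I (c al) z) * phi (node a H al)].

(** A cell, or the part of the inflow boundary on a cell, is in general neither
    a box nor a simplex nor planar: composite rules are allowed.  On the empty
    set the only such rule is 0. *)
Definition newton_cotes (mu : {outer_measure set pt -> \bar R})
    (S : set pt) (Q : (pt -> R) -> R) :=
  exists (m : nat) (P : 'I_m -> set pt) (q : 'I_m -> (pt -> R) -> R),
    [/\ (forall j, mu.-cara.-measurable (P j)),
        trivIset setT P /\ \bigcup_j P j = S,
        (forall j, newton_cotes_simple mu (P j) (q j)) &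
        forall phi, Q phi = \sum_j q j phi].

End quadrature.

(** * Discrete least squares *)

Section discrete.
Context {R : realType} {d : nat}.
Notation pt := 'cV[R]_d.+1.

(** The cells of a partition cover the domain up to their boundaries. *)
Definition mesh_of (Om : set pt) (mesh : set (set pt)) :=
  [/\ finite_set mesh,
      (forall K, mesh K -> domain K /\ K `<=` Om),
      trivIset mesh id &
      closure Om = \bigcup_(K in mesh) closure K].

Definition inflow_mesh (mesh : set (set pt)) (Gm : set pt) : set (set pt) :=
  [set boundary K `&` Gm | K in mesh].

(** [divT K F z] is the value of the discrete divergence of the field [F] at the
    node [z] of the quadrature on the cell [K]. *)
Definition discrete_ls_functional (f : 'I_d -> R -> R) (mesh : set (set pt))
    (Gm : set pt) (QK QE : set pt -> (pt -> R) -> R)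
    (divT : set pt -> (pt -> pt) -> pt -> R) (g v : pt -> R) : R :=
  \sum_(K \in mesh) QK K (divT K (stflux f \o v)) ^+ 2 +
  \sum_(E \in inflow_mesh mesh Gm) QE E (v \- g) ^+ 2.

End discrete.

Definition minimizer {disp : Order.disp_t} {Y : porderType disp} {X : Type}
    (M : set X) (L : X -> Y) (u : X) :=
  M u /\ forall v, M v -> (L u <= L v)%O.

(* Main.v *)
Require Import Defs.
From mathcomp Require Import all_boot all_order all_algebra.
From mathcomp Require Import all_classical all_reals all_analysis.

Set Implicit Arguments.
Unset Strict Implicit.
Unset Printing Implicit Defensive.
Import Order.TTheory GRing.Theory Num.Theory.
Import numFieldNormedType.Exports.
Local Open Scope classical_set_scope.
Local Open Scope ring_scope.

(** The minimizers enter through one comparison only: as the continuous minimizer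
    [uN] is a network, the discrete functional is at [uNT] at most what it is at
    [uN].  Going from [L uNT] to [LT uNT], up to [LT uN], and back to [L uN]
    costs the two consistency errors [L - LT] at [uNT] and at [uN].  This
    argument concerns four numbers, the values of both functionals at both
    networks, and is isolated in [le_abse_perturbation].  The values of [L] may
    be infinite; the errors that they contribute are then infinite too, so that
    the bound survives. *)

(** Here [a] and [b] are approximations of [x] and [y].  For finite values this
    is [x <= `|x - a| + a], then [a <= b], then [b <= `|y - b| + `|y|].  An
    infinite [x] or [y], of either sign, makes the right-hand side [+oo]. *)
Lemma le_abse_perturbation (R : realDomainType) (x y : \bar R) (a b : R) :
  a <= b -> (x <= `|x - a%:E| + `|y - b%:E| + `|y|)%E.
Proof.
move=> ab; case: x y => [x| |] [y| |] //=; rewrite ?leey ?leNye //.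
rewrite -!EFinD lee_fin.
have hx := ler_norm (x - a).
have hb : b <= `|y - b| + `|y|.
  rewrite distrC; apply: le_trans (ler_norm b) _.
  by rewrite -{1}(subrK y b) ler_normD.
rewrite -addrA; apply: le_trans (lerD hx hb).
by rewrite -{1}(subrK a x) lerD2l.
Qed.

Theorem lemma3p3 (R : realType) (d : nat) (hd : (1 <= d <= 3)%N)
  (Ot : set 'cV[R]_d) (hOt : domain Ot) (hOtb : bounded_set Ot)
  (hOtl : lipschitz_boundary Ot) (Tend : R) (hT : 0 < Tend)
  (f : 'I_d -> R -> R)
  (hf : forall i s, derivable (f i) s 1 /\ derivable (derive1 (f i)) s 1)
  (u g : 'cV[R]_d.+1 -> R)
  (hg : square_integrable (@hausdorff R d.+1 d) (inflow f Ot Tend u) g)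
  (ws : seq nat) (hws : all (leq 1) ws)
  (mesh : set (set 'cV[R]_d.+1)) (hmesh : mesh_of (cylinder Ot Tend) mesh)
  (QK QE : set 'cV[R]_d.+1 -> ('cV[R]_d.+1 -> R) -> R)
  (hQK : forall K, mesh K -> newton_cotes (@lebesgue R d.+1) K (QK K))
  (hQE : forall E, inflow_mesh mesh (inflow f Ot Tend u) E ->
    newton_cotes (@hausdorff R d.+1 d) E (QE E))
  (divT : set 'cV[R]_d.+1 -> ('cV[R]_d.+1 -> 'cV[R]_d.+1) -> 'cV[R]_d.+1 -> R)
  (uN uNT : 'cV[R]_d.+1 -> R) :
  let MN := @relu_net R ws d.+1 in
  let Gm := inflow f Ot Tend u in
  let L v := ls_functional f (cylinder Ot Tend) Gm g v in
  let LT v := discrete_ls_functional f mesh Gm QK QE divT g v in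
  minimizer MN L uN ->
  minimizer MN LT uNT ->
  (L uNT <= `|L uNT - (LT uNT)%:E| + `|L uN - (LT uN)%:E| + `|L uN|)%E.
Proof.
move=> MN Gm L LT [MNuN _] [_ LTmin].
exact/le_abse_perturbation/LTmin.
Qed.
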